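(* Let $s\ge 1$ be an integer, let $k_0,\dots,k_s\ge 0$, $l_0,l_1,\dots,l_s\ge 0$ and $l_{s+1}\ge 2$ be integers, and let $\mathcal C$ be the geometric class with code $$\mathrm G^{l_{s+1}}\,\mathrm S\,\mathrm T^{k_s}\,\mathrm G^{l_s}\,\mathrm S\,\mathrm T^{k_{s-1}}\,\mathrm G^{l_{s-1}}\cdots \mathrm S\,\mathrm T^{k_1}\,\mathrm G^{l_1}\,\mathrm S\,\mathrm T^{k_0}\,\mathrm G^{l_0}.$$ Assume that among $l_1,\dots,l_s$ exactly $l_{n_1},l_{n_2},\dots,l_{n_q}$ are non-zero (positive), where $1\le q\le s$ and $1\le n_1<n_2<\dots<n_q\le s$. Define $$A_0=1,\quad A_1=2+k_0,\quad A_j=A_{j-2}+(1+k_{j-1})A_{j-1}\quad(2\le j\le s+1),$$ and, for $1\le N\le s$, $$A^{+N}_0=1,\quad A^{+N}_1=2+k_N,\quad A^{+N}_j=A^{+N}_{j-2}+(1+k_{j-1+N})A^{+N}_{j-1}\quad(2\le j,\ N+j\le s+1).$$ For $1\le i\le q$ put $P_i=A_{n_1}\prod_{j=1}^{i-1}A^{+n_j}_{n_{j+1}-n_j}$ (so $P_1=A_{n_1}$). Then the derived vector $\mathrm{der}(\mathcal C)$ is non-decreasing, and exactly $s+2$ different values $v_0<v_1<\dots<v_{s+1}$ appear in it. In growing order, they are listed in the following $q+1$ consecutive rows: - first row: $A_0,\,A_1,\dots,A_{n_1-1}$ (these are $v_0,\dots,v_{n_1-1}$); - for each $i=1,\dots,q-1$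 (in this order), the row $P_iA^{+n_i}_0,\,P_iA^{+n_i}_1,\dots,P_iA^{+n_i}_{n_{i+1}-n_i-1}$ (these are $v_{n_i},\dots,v_{n_{i+1}-1}$); - last row: $P_qA^{+n_q}_0,\,P_qA^{+n_q}_1,\dots,P_qA^{+n_q}_{s-n_q+1}$ (these are $v_{n_q},\dots,v_{s+1}$). Their multiplicities are as follows: - $v_0=A_0$ appears $2+k_0+l_0$ times in a row; - for $1\le j\le s$, $v_j$ appears $1+k_j+l_j$ times in a row (that is, $1+k_j$ times when $j\notin\{n_1,\dots,n_q\}$); - the last and biggest value $v_{s+1}$ appears $l_{s+1}-1$ times in a row.
   Context: A word of length $r\ge 2$ over the alphabet $\{\mathrm G,\mathrm S,\mathrm T\}$ is called admissible if it starts with $\mathrm{GG}$ and does not contain $\mathrm{GT}$ as two consecutive letters. Exponents denote repetition of letters. Admissible words of length $r$ are the codes of the geometric classes of germs of Goursat flags of length $r$ (rank-2 Goursat distributions of corank $r$ on manifolds of dimension $r+2$). A geometric class is identified with its code. The small growth vector of a distribution $D$ at a point $p$ is the sequence of dimensions $\dim V_j(p)$, where $V_1=D$ and $V_{j+1}=V_j+[D,V_j]$. It depends only on the geometric class $\mathcal C$ of the Goursat germ. It starts with $2$, takes all integer values up to $r+2$, and ends with $r+2$. The derived vector of a class $\mathcal C$ of length $r$ is the function $\mathrm{der}(\mathcal C):\{2,3,\dots,r+1\}\to\mathbb N$, written as the finite sequence of its values, where $\mathrm{der}(\mathcal C)(j)$ is the multiplicity of $j$ in the small growth vector of $\mathcal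 C$. By a known theorem of Jean, which can be taken here as the definition of $\mathrm{der}(\mathcal C)$, one has $\mathrm{der}(\mathcal C)=d^{\,r}$, where the functions $d^{\,j}:\{2,\dots,j+1\}\to\mathbb N$ are given by $d^{\,1}=(1)$, $d^{\,2}=(1,1)$ and, for $1\le j\le r-2$, $d^{\,j+2}=\mathrm G(d^{\,j+1})$, $\mathrm S(d^{\,j},d^{\,j+1})$ or $\mathrm T(d^{\,j},d^{\,j+1})$ according to whether the $(j+2)$-nd letter of the code is $\mathrm G$, $\mathrm S$ or $\mathrm T$. The operations are defined as follows. If $\beta=(\beta(2),\dots,\beta(m+1))$ is a sequence of length $m$ indexed from $2$, then $\mathrm G(\beta)=(1,\beta(2),\dots,\beta(m+1))$. If moreover $\alpha=(\alpha(2),\dots,\alpha(m))$ has length $m-1$, then $\mathrm S(\alpha,\beta)$ and $\mathrm T(\alpha,\beta)$ have length $m+1$ and are $$\mathrm S(\alpha,\beta)=(1,1,\alpha(2)+\beta(3),\alpha(3)+\beta(4),\dots,\alpha(m)+\beta(m+1)),$$ $$\mathrm T(\alpha,\beta)=(1,1,2\beta(3)-\alpha(2),2\beta(4)-\alpha(3),\dots,2\beta(m+1)-\alpha(m)).$$ *)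

(* Defs.v *)
From mathcomp Require Import all_boot all_order all_algebra.
Set Implicit Arguments.
Unset Strict Implicit.
Unset Printing Implicit Defensive.
Import Order.TTheory GRing.Theory Num.Theory.
Local Open Scope ring_scope.

Inductive letter : Type := LG | LS | LT.

Definition admissible (w : seq letter) : Prop :=
  (exists w', w = [:: LG, LG & w']) /\
  (forall w1 w2, w <> w1 ++ [:: LG; LT] ++ w2).

(* A geometric class of Goursat germs is identified with its code. *)
Record geometric_class : Type := GeometricClass {
  code :> seq letter;
  code_admissible : admissible code
}.

(* A function on {2, ..., m+1} is the sequence of its m values, so that beta(i)
   is stored at position i - 2. Values are in int rather than nat because the
   operation T involves a subtraction, which must not be truncated. In opS and
   opT, alpha(i) is paired with beta(i + 1), whence the behead. *)
Definition opG (beta : seq int) : seq int := 1 :: beta.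

Definition opS (alpha beta : seq int) : seq int :=
  [:: 1, 1 & [seq x.1 + x.2 | x <- zip alpha (behead beta)]].

Definition opT (alpha beta : seq int) : seq int :=
  [:: 1, 1 & [seq 2 * x.2 - x.1 | x <- zip alpha (behead beta)]].

Definition op_letter (x : letter) (alpha beta : seq int) : seq int :=
  match x with
  | LG => opG beta
  | LS => opS alpha beta
  | LT => opT alpha beta
  end.

(* [jean w j] is d^j for the word w; d^0 is a dummy. The letters of w are
   numbered from 1, so the (j+2)-nd letter is [nth LG w j.+1]. *)
Fixpoint jean (w : seq letter) (m : nat) : seq int :=
  match m with
  | 0 => [::]
  | j'.+1 =>
    match j' with
    | 0 => [:: 1]
    | j.+1 =>
      match j with
      | 0 => [:: 1; 1]
      | _.+1 => op_letter (nth LG w j') (jean w j) (jean w j')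
      end
    end
  end.

Definition der (C : geometric_class) : seq int := jean C (size C).

Section Words.
Local Open Scope nat_scope.

(* S T^(k_s) G^(l_s) S T^(k_(s-1)) G^(l_(s-1)) ... S T^(k_0) G^(l_0) *)
Fixpoint blocks (k l : nat -> nat) (s : nat) : seq letter :=
  LS :: nseq (k s) LT ++ nseq (l s) LG ++
    (if s is s'.+1 then blocks k l s' else [::]).

Definition block_word (k l : nat -> nat) (s : nat) : seq letter :=
  nseq (l s.+1) LG ++ blocks k l s.

(* The hypothesis [code C = block_word k l s] is satisfiable for all k, l, s
   with l_(s+1) >= 2. *)
Lemma block_word_admissible (k l : nat -> nat) (s : nat) :
  2 <= l s.+1 -> admissible (block_word k l s).
Proof.
move=> hl; split.
  rewrite /block_word; case: (l s.+1) hl => [|[|m]] // _.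
  by exists (nseq m LG ++ blocks k l s).
pose r x y := match x, y with LG, LT => false | _, _ => true end.
have pT x m u : x <> LG -> (forall y, y <> LG -> path r y u) ->
    path r x (nseq m LT ++ u).
  move=> hx hu; elim: m x hx => [|m IH] x hx /=; first exact: hu.
  by rewrite IH // andbT; case: x hx.
have pG' x m u : (forall y, path r y u) -> path r x (nseq m LG ++ u).
  move=> hu; elim: m x => [|m IH] x /=; first exact: hu.
  by rewrite IH andbT; case: x.
have pB x n : path r x (blocks k l n).
  elim: n x => [|n IH] x /=; apply/andP; split; try by case: x.
    by apply: pT => // y _; apply: pG'.
  by apply: pT => // y _; apply: pG'.
have : path r LS (block_word k l s) by apply: pG'.
move=> hp w1 w2 e; move: hp; rewrite e cat_path /=.
by rewrite !andbF.
Qed.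

Fixpoint A (k : nat -> nat) (j : nat) : nat :=
  match j with
  | 0 => 1
  | j'.+1 => match j' with
             | 0 => 2 + k 0
             | i.+1 => A k i + (1 + k j') * A k j'
             end
  end.

(* A^{+N}: the same recursion, with k_i replaced by k_(i+N) throughout. *)
Definition Aplus (k : nat -> nat) (N j : nat) : nat := A (fun i => k (i + N)) j.

Definition P (k n : nat -> nat) (i : nat) : nat :=
  A k (n 1) * \prod_(1 <= j < i) Aplus k (n j) (n j.+1 - n j).

End Words.

(* x occurs in u exactly m times, and these occurrences are consecutive. *)
Definition appears_in_a_row (x : int) (m : nat) (u : seq int) : Prop :=
  exists u1 u2, [/\ u = u1 ++ nseq m x ++ u2, x \notin u1 & x \notin u2].

(* Main.v *)
(** Consecutive vectors alpha = d^(m-1) and beta = d^m with beta(2) = 1 are stored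
    as one sequence of pairs (alpha(i), beta(i+1)). The word S T^a acts on every
    pair by the linear map (x, y) |-> (a x + y, (a+1) x + y) and puts a + 1 pairs
    (1, 1) in front; G^b acts, when b > 0, by (x, y) |-> (y, y), and puts b pairs
    (1, 1) in front. Hence each block of the code creates one run of equal
    values, and the maps of the later blocks, applied to (1, 1), give the value:
    it satisfies the recursion of the A_j when no G intervenes, and starts afresh
    as a multiple of an A^{+N} after each non-empty group of G's. *)
Require Import Defs.
From mathcomp Require Import all_boot all_order all_algebra.
From mathcomp Require Import zify.
Import Order.TTheory GRing.Theory Num.Theory.
Local Open Scope nat_scope.

(** * Jean's recursion as a left fold over the code *)

Definition step (ab : seq int * seq int) (x : letter) : seq int * seq int :=
  (ab.2, op_letter x ab.1 ab.2).

(** Since the code starts with two letters [LG], [d^1] and [d^2] also arise by [opG] from the empty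
    dummy [d^0], so one rule covers every step. *)
Lemma jean_step w m :
  jean [:: LG, LG & w] m.+1 =
  op_letter (nth LG [:: LG, LG & w] m)
    (jean [:: LG, LG & w] m.-1) (jean [:: LG, LG & w] m).
Proof. by case: m => [|[|m]]. Qed.

Lemma foldl_step_take w m : m <= size [:: LG, LG & w] ->
  foldl step ([::], [::]) (take m [:: LG, LG & w]) =
  (jean [:: LG, LG & w] m.-1, jean [:: LG, LG & w] m).
Proof.
elim: m => [|m IH] hm; first by rewrite take0.
by rewrite (take_nth LG) // foldl_rcons IH 1?ltnW // jean_step.
Qed.

Lemma der_foldl (C : geometric_class) :
  der C = (foldl step ([::], [::]) (code C)).2.
Proof.
case: C => w hw; have [[w' e] _] := hw; rewrite /der /= e.
by rewrite -[in RHS](take_size [:: LG, LG & w']) foldl_step_take.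
Qed.

(** * Action of letters and blocks on pairs *)

Definition state (u : seq (nat * nat)) : seq int * seq int :=
  ([seq Posz z.1 | z <- u], Posz 1 :: [seq Posz z.2 | z <- u]).

Lemma zip_state (u : seq (nat * nat)) :
  zip [seq Posz z.1 | z <- u] [seq Posz z.2 | z <- u] =
  [seq (Posz z.1, Posz z.2) | z <- u].
Proof. by elim: u => //= z u ->. Qed.

Definition ST_map (a : nat) (z : nat * nat) : nat * nat :=
  (a * z.1 + z.2, a.+1 * z.1 + z.2).

Lemma state_LS u : step (state u) LS = state ((1, 1) :: map (ST_map 0) u).
Proof.
rewrite /step /state /= /opS /= zip_state -!map_comp; congr (_ :: _, _ :: _ :: _);
  apply: eq_map => z /=; lia.
Qed.

(** [2 * x.2 - x.1] continues the arithmetic progression [y + a x], [y + (a+1) x] by one term. The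
    subtraction thus never leaves the natural numbers. *)
Lemma state_LT a u :
  step (state (nseq a.+1 (1, 1) ++ map (ST_map a) u)) LT =
  state (nseq a.+2 (1, 1) ++ map (ST_map a.+1) u).
Proof.
rewrite /step /state /= /opT /= zip_state !map_cat !map_nseq -!map_comp.
congr (_ :: _ :: _, _ :: _ :: _ :: _); congr (_ ++ _); apply: eq_map => z /=; lia.
Qed.

Lemma state_LS_LT a u :
  foldl step (state u) (LS :: nseq a LT) =
  state (nseq a.+1 (1, 1) ++ map (ST_map a) u).
Proof.
elim: a => [|a IH]; first exact: state_LS.
by rewrite -addn1 nseqD -cat_cons foldl_cat IH /= addn1 -state_LT.
Qed.

Definition G_map (b : nat) (z : nat * nat) : nat * nat :=
  if b is 0 then z else (z.2, z.2).

Lemma foldl_LG b ab :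
  foldl step ab (nseq b.+1 LG) =
  (nseq b (Posz 1) ++ ab.2, nseq b.+1 (Posz 1) ++ ab.2).
Proof.
elim: b => [|b IH]; first by [].
by rewrite -[in LHS]addn1 nseqD foldl_cat IH.
Qed.

(** After a letter [LG], [beta] is [1 :: alpha], so paired entries coincide; further letters [LG]
    keep them so. *)
Lemma state_LG b u :
  foldl step (state u) (nseq b LG) = state (nseq b (1, 1) ++ map (G_map b) u).
Proof.
case: b => [|b]; first by rewrite /= map_id.
rewrite foldl_LG /state /= !map_cat !map_nseq -!map_comp /=.
have e (w : seq int) : nseq b (Posz 1) ++ Posz 1 :: w = Posz 1 :: nseq b (Posz 1) ++ w.
  by elim: b => //= b ->.
by rewrite e.
Qed.

Definition block_map (k l : nat -> nat) (j : nat) (z : nat * nat) : nat * nat :=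
  G_map (l j) (ST_map (k j) z).

(** [G_map] fixes [(1, 1)], so the pairs created by [S T^(k j)] and by [G^(l j)] merge into one
    run. *)
Lemma state_block k l j u :
  foldl step (state u) (LS :: nseq (k j) LT ++ nseq (l j) LG) =
  state (nseq (1 + k j + l j) (1, 1) ++ map (block_map k l j) u).
Proof.
rewrite -cat_cons foldl_cat state_LS_LT state_LG map_cat map_nseq -map_comp.
rewrite catA; congr (state (_ ++ _)).
have -> : G_map (l j) (1, 1) = (1, 1) by case: (l j).
by rewrite -nseqD addnC.
Qed.

(** What happens to a pair created by block [j]: the blocks [j - 1], ..., [0] follow it in the code
    and act in this order. *)
Fixpoint blocks_map (k l : nat -> nat) (j : nat) (z : nat * nat) : nat * nat :=
  if j is i.+1 then blocks_map k l i (block_map k l i z) else z.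

Lemma state_blocks k l s u :
  foldl step (state u) (blocks k l s) =
  state (flatten [seq nseq (1 + k j + l j) (blocks_map k l j (1, 1))
                 | j <- iota 0 s.+1] ++ map (blocks_map k l s.+1) u).
Proof.
elim: s u => [|s IH] u.
  by rewrite [blocks _ _ _]/= cats0 state_block [flatten _]/= cats0.
rewrite [blocks _ _ _]/= catA -cat_cons foldl_cat state_block IH.
rewrite map_cat map_nseq -map_comp catA -[in RHS](addn1 s.+1) iotaD map_cat.
by rewrite flatten_cat [flatten [seq _ | _ <- iota _ 1]]/= cats0 (addn1 s.+1).
Qed.

(** * The recursion for the values and its restarts *)

Fixpoint value (k l : nat -> nat) (j : nat) : nat :=
  match j with
  | 0 => 1
  | j'.+1 => match j' with
             | 0 => 2 + k 0
             | i.+1 => (1 + k j') * value k l j' +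
                       (if 0 < l j' then value k l j' else value k l i)
             end
  end.

Lemma valueSS k l j :
  value k l j.+2 = (1 + k j.+1) * value k l j.+1 +
                   (if 0 < l j.+1 then value k l j.+1 else value k l j).
Proof. by []. Qed.

(* The subtraction-free form of [(v_(j+1) - v_j) x + v_j y]. *)
Lemma blocks_map_snd k l j x y :
  (blocks_map k l j.+1 (x, y)).2 + value k l j * x =
  value k l j.+1 * x + value k l j * y.
Proof.
elim: j x y => [|j IH] x y.
  (* [G_map] keeps the second coordinate, so both cases give the same equation. *)
  by rewrite /= /block_map /ST_map /G_map; case: (l 0) => [|?] /=; lia.
have -> : blocks_map k l j.+2 (x, y) =
          blocks_map k l j.+1 (block_map k l j.+1 (x, y)) by [].
rewrite valueSS /block_map /G_map /ST_map.
case: (l j.+1) => [|b] /=.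
  have := IH (k j.+1 * x + y) ((k j.+1).+1 * x + y); rewrite /=; nia.
(* On a diagonal pair [(t, t)] the linear form reduces to [value k l j.+1 * t], and [value k l j]
   drops out. *)
have := IH ((k j.+1).+1 * x + y) ((k j.+1).+1 * x + y); rewrite /=; nia.
Qed.

Lemma blocks_map_value k l j : (blocks_map k l j (1, 1)).2 = value k l j.
Proof.
case: j => [//|j]; have := blocks_map_snd k l j 1 1; lia.
Qed.

Lemma value_gt0 k l j : 0 < value k l j.
Proof.
elim/ltn_ind: j => -[|[|j]] IH //; rewrite valueSS.
by have := IH j.+1 (ltnSn _); nia.
Qed.

Lemma value_ltS k l j : value k l j < value k l j.+1.
Proof.
case: j => [|j] //; rewrite valueSS.
have := value_gt0 k l j; have := value_gt0 k l j.+1.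
by case: ifP => _; nia.
Qed.

Lemma value_lt k l : {homo value k l : i j / i < j}.
Proof. by apply: homo_ltn => [? ? ?|i]; [apply: ltn_trans|apply: value_ltS]. Qed.

Lemma eq_A k k' : k =1 k' -> A k =1 A k'.
Proof.
move=> e j; elim/ltn_ind: j => -[|[|j]] IH //; first by rewrite /= e.
have -> : A k j.+2 = A k j + (1 + k j.+1) * A k j.+1 by [].
by rewrite e !IH.
Qed.

(* At an index [N > 0] with [l N > 0], the recursion for [value] forgets
   [value (N - 1)], so it restarts with first ratio [2 + k N]. *)
Lemma value_Aplus k l N j :
  N = 0 \/ 0 < l N -> (forall i, N < i < N + j -> l i = 0) ->
  value k l (N + j) = value k l N * Aplus k N j.
Proof.
move=> hN; elim/ltn_ind: j => -[|[|j]] IH hl.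
- by rewrite addn0 muln1.
- rewrite addn1; case: N hN {IH hl} => [|N] hN; first by rewrite mul1n.
  have {}hN : 0 < l N.+1 by case: hN.
  by rewrite valueSS hN /Aplus [A _ 1]/= add0n; nia.
have -> : Aplus k N j.+2 = Aplus k N j + (1 + k (j.+1 + N)) * Aplus k N j.+1 by [].
rewrite !addnS valueSS (hl (N + j).+1) ?ltnn; last lia.
rewrite -addnS IH //; last by move=> i hi; apply: hl; lia.
rewrite IH //; last by move=> i hi; apply: hl; lia.
by rewrite (addnC N j.+1); nia.
Qed.

(** * Sequences made of runs of equal values *)

Definition runs (v mu : nat -> nat) (js : seq nat) : seq int :=
  flatten [seq nseq (mu j) (Posz (v j)) | j <- js].

Lemma mem_runs v mu js x : x \in runs v mu js -> exists2 j, j \in js & x = Posz (v j).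
Proof.
by case/flatten_mapP => j hj; rewrite mem_nseq => /andP[_ /eqP ->]; exists j.
Qed.

Lemma runs_sorted v mu js :
  {homo v : i j / i < j} -> sorted ltn js -> sorted <=%R (runs v mu js).
Proof.
move=> v_lt.
(* By transitivity, sortedness is a condition on all pairs of entries, which splits over
   concatenation. *)
rewrite (sorted_pairwise ltn_trans) (sorted_pairwise le_trans).
elim: js => [//|j js IH] /= /andP[/allP hj hjs].
rewrite /runs /= pairwise_cat IH // andbT; apply/andP; split.
  apply/allrelP => x y; rewrite mem_nseq => /andP[_ /eqP ->] /mem_runs[i hi ->].
  by rewrite lez_nat ltnW // v_lt // hj.
elim: (mu j) => //= m ->; rewrite andbT.
by apply/allP => x; rewrite mem_nseq => /andP[_ /eqP ->].
Qed.

Lemma homo_ltn_inj (v : nat -> nat) : {homo v : i j / i < j} -> injective v.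
Proof.
move=> v_lt i j e; apply/eqP; rewrite eqn_leq.
by apply/andP; split; rewrite leqNgt; apply/negP => /v_lt; rewrite e ltnn.
Qed.

(** Injectivity of [v] keeps [v j] out of the runs of the other indices. *)
Lemma runs_in_a_row v mu m j : {homo v : i j / i < j} -> j < m ->
  appears_in_a_row (Posz (v j)) (mu j) (runs v mu (iota 0 m)).
Proof.
move=> /homo_ltn_inj v_inj hj.
exists (runs v mu (iota 0 j)), (runs v mu (iota j.+1 (m - j.+1))); split.
- have -> : iota 0 m = iota 0 j ++ j :: iota j.+1 (m - j.+1).
    by rewrite -[j :: _]/(iota j (m - j.+1).+1) -iotaD; congr iota; lia.
  by rewrite /runs map_cat flatten_cat.
- by apply/negP => /mem_runs[i]; rewrite mem_iota => hi [] /v_inj; lia.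
- by apply/negP => /mem_runs[i]; rewrite mem_iota => hi [] /v_inj; lia.
Qed.

Lemma runs_eqi v mu js : (forall j, 0 < mu j) ->
  runs v mu js =i [seq Posz (v j) | j <- js].
Proof.
move=> mu_gt0 x; apply/idP/mapP; first exact: mem_runs.
move=> [j hj ->]; apply/flatten_mapP; exists j => //.
by rewrite mem_nseq mu_gt0 eqxx.
Qed.

Lemma size_undup_runs v mu js :
  {homo v : i j / i < j} -> (forall j, 0 < mu j) -> uniq js ->
  size (undup (runs v mu js)) = size js.
Proof.
move=> /homo_ltn_inj v_inj mu_gt0 hjs; rewrite -(size_map (fun j => Posz (v j)) js).
apply/perm_size/uniq_perm; first exact: undup_uniq.
  by rewrite map_inj_uniq // => i j [] /v_inj.
by move=> x; rewrite mem_undup runs_eqi.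
Qed.

(** * The derived vector as runs, and the rows of values *)

Definition multiplicity (k l : nat -> nat) (s j : nat) : nat :=
  if j == 0 then 2 + k 0 + l 0
  else if j <= s then 1 + k j + l j else l s.+1 - 1.

Lemma der_runs s k l (C : geometric_class) :
  2 <= l s.+1 -> code C = block_word k l s ->
  der C = runs (value k l) (multiplicity k l s) (iota 0 s.+2).
Proof.
move=> hl hC; rewrite der_foldl hC /block_word foldl_cat.
(* The initial letters [LG] leave [l s.+1] ones in [beta] but one fewer in [alpha], hence one fewer
   pair. *)
have -> : foldl step ([::], [::]) (nseq (l s.+1) LG) =
          state (nseq (l s.+1 - 1) (1, 1)).
  case: (l s.+1) hl => [//|b] _.
  by rewrite foldl_LG /state !map_nseq /= !cats0 subn1.
(* The initial pairs pass through all [s.+1] blocks and form the last run. *)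
rewrite state_blocks map_nseq.
set f := fun z : nat * nat => Posz z.2.
have f_run m j :
    map f (nseq m (blocks_map k l j (1, 1))) = nseq m (Posz (value k l j)).
  by rewrite map_nseq /f blocks_map_value.
rewrite -[LHS]/(Posz 1 :: map f _) map_cat map_flatten -map_comp f_run.
rewrite -[s.+2]addn1 iotaD /runs map_cat flatten_cat -cat_cons; congr (_ ++ _).
  (* The entry [beta(2) = 1], kept outside the pairs, joins the run of [value k l 0 = 1]; this gives
     2 instead of 1 in its multiplicity. *)
  rewrite /= map_nseq; congr (_ :: _ :: _ ++ flatten _).
  apply/eq_in_map => j; rewrite mem_iota => hj.
  have -> : multiplicity k l s j = 1 + k j + l j.
    rewrite /multiplicity; have -> : j == 0 = false by lia.
    by have -> : j <= s by lia.
  exact: (f_run (1 + k j + l j)).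
by rewrite /= cats0 /multiplicity /= ltnn.
Qed.

(** The product telescopes: by [value_Aplus], each factor is the ratio of the values at [n j.+1] and
    [n j]. *)
Lemma P_value k l n i : 1 <= i ->
  (forall j, j < n 1 -> 0 < j -> l j = 0) ->
  (forall j, 1 <= j <= i -> 0 < l (n j)) ->
  (forall j, 1 <= j < i -> n j < n j.+1) ->
  (forall j m, 1 <= j < i -> n j < m < n j.+1 -> l m = 0) ->
  P k n i = value k l (n i).
Proof.
case: i => [//|i] _ h0 hpos hlt hgap.
have e1 : A k (n 1) = value k l (n 1).
  rewrite -[n 1 in RHS]add0n value_Aplus ?mul1n; first by apply: eq_A => j; rewrite addn0.
    by left.
  by move=> j hj; apply: h0; lia.
elim: i hpos hlt hgap => [|i IH] hpos hlt hgap; first by rewrite /P big_geq ?muln1.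
rewrite /P big_nat_recr //= mulnA -/(P k n i.+1) IH.
- rewrite -value_Aplus; first by rewrite subnKC // ltnW // hlt; lia.
    by right; apply: hpos; lia.
  by move=> j hj; apply: (hgap i.+1); have := hlt i.+1; lia.
- by move=> j hj; apply: hpos; lia.
- by move=> j hj; apply: hlt; lia.
- by move=> j m hj; apply: hgap; lia.
Qed.

Theorem theorem3 (s : nat) (k l : nat -> nat) (C : geometric_class)
    (q : nat) (n : nat -> nat)
    (hs : 1 <= s) (hl : 2 <= l s.+1)
    (hC : code C = block_word k l s)
    (hq : 1 <= q <= s)
    (hn_range : forall i, 1 <= i <= q -> 1 <= n i <= s)
    (hn_incr : forall i j, 1 <= i -> i < j -> j <= q -> n i < n j)
    (hn : forall j, 1 <= j <= s ->
       (0 < l j <-> exists i, 1 <= i <= q /\ j = n i)) :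
  exists v : nat -> nat,
    sorted <=%R (der C) /\
    size (undup (der C)) = s.+2 /\
    (forall i j, i < j -> j <= s.+1 -> v i < v j) /\
    (forall x : int, x \in der C <-> exists j, j <= s.+1 /\ x = (Posz (v j))) /\
    (forall j, j < n 1 -> v j = A k j) /\
    (forall i, 1 <= i < q -> forall j, j < n i.+1 - n i ->
       v (n i + j) = P k n i * Aplus k (n i) j) /\
    (forall j, j <= s - n q + 1 ->
       v (n q + j) = P k n q * Aplus k (n q) j) /\
    appears_in_a_row (Posz (v 0)) (2 + k 0 + l 0) (der C) /\
    (forall j, 1 <= j <= s ->
       appears_in_a_row (Posz (v j)) (1 + k j + l j) (der C)) /\
    (forall j, 1 <= j <= s -> (forall i, 1 <= i <= q -> j <> n i) ->
       appears_in_a_row (Posz (v j)) (1 + k j) (der C)) /\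
    appears_in_a_row (Posz (v s.+1)) (l s.+1 - 1) (der C).
Proof.
have hinc i : 1 <= i < q -> n i < n i.+1 by move=> hi; apply: hn_incr; lia.
have hmono i j : 1 <= i <= j -> j <= q -> n i <= n j.
  move=> /andP[hi]; rewrite leq_eqVlt => /orP[/eqP -> //|hij] hj.
  by apply/ltnW/hn_incr.
have hpos i : 1 <= i <= q -> 0 < l (n i).
  by move=> hi; apply/hn; [exact: hn_range|exists i].
have hzero j : 1 <= j <= s -> (forall i, 1 <= i <= q -> j <> n i) -> l j = 0.
  move=> hj hne; case: (posnP (l j)) => // /(hn _ hj)[i [hi e]].
  by case: (hne i hi e).
(* Index 0 is left out because [l 0] is arbitrary. *)
have hfirst j : j < n 1 -> 0 < j -> l j = 0.
  move=> hj j0; apply: hzero; first by have := hn_range 1; lia.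
  by move=> i hi e; have := hmono 1 i; lia.
have hgap i m : 1 <= i < q -> n i < m < n i.+1 -> l m = 0.
  move=> hi hm; apply: hzero; first by have := hn_range i.+1; lia.
  move=> j hj e; case: (leqP j i) => hji; first by have := hmono j i; lia.
  by have := hmono i.+1 j; lia.
have hlast m : n q < m <= s -> l m = 0.
  move=> hm; apply: hzero; first by lia.
  by move=> j hj e; have := hmono j q; lia.
have hP i : 1 <= i <= q -> P k n i = value k l (n i).
  move=> hi; apply: P_value => //; first by lia.
  - by move=> j hj; apply: hpos; lia.
  - by move=> j hj; apply: hinc; lia.
  - by move=> j m hj; apply: hgap; lia.
have v_lt := value_lt k l.
have mu_gt0 j : 0 < multiplicity k l s j.
  (* The last run is non-empty because [l s.+1] is at least 2. *)
  by rewrite /multiplicity; case: ifP => _; [|case: ifP => _]; lia.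
have hder := der_runs _ _ _ _ hl hC.
have row j : j <= s.+1 ->
    appears_in_a_row (Posz (value k l j)) (multiplicity k l s j) (der C).
  by move=> hj; rewrite hder; apply: runs_in_a_row.
exists (value k l).
split; first by rewrite hder runs_sorted // iota_ltn_sorted.
split; first by rewrite hder size_undup_runs ?size_iota ?iota_uniq.
split; first by move=> i j hij _; apply: v_lt.
split.
  move=> x; rewrite hder runs_eqi //; split.
    by move=> /mapP[j]; rewrite mem_iota => hj ->; exists j; split; first lia.
  by move=> [j [hj ->]]; apply/mapP; exists j => //; rewrite mem_iota; lia.
split.
  move=> j hj; rewrite -[j in LHS]add0n value_Aplus; [|by left|].
    by rewrite mul1n; apply: eq_A => i; rewrite addn0.
  by move=> i hi; apply: hfirst; lia.
split.
  move=> i hi j hj; rewrite hP; last lia.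
  rewrite value_Aplus //; first by right; apply: hpos; lia.
  by move=> m hm; apply: (hgap i); lia.
split.
  move=> j hj; rewrite hP; last lia.
  rewrite value_Aplus //; first by right; apply: hpos; lia.
  (* Since [n q <= s], the bound on [j] forces [m <= s], so the positive [l s.+1] is never met. *)
  by move=> m hm; apply: hlast; have := hn_range q; lia.
split; first exact: row.
have mid j : 1 <= j <= s ->
    appears_in_a_row (Posz (value k l j)) (1 + k j + l j) (der C).
  move=> hj; have := row j; rewrite /multiplicity.
  have -> : j == 0 = false by lia.
  have -> : j <= s by lia.
  by apply; lia.
split; first exact: mid.
split; first by move=> j hj hne; have := mid j hj; rewrite hzero ?addn0.
by have := row s.+1 (leqnn _); rewrite /multiplicity /= ltnn.
Qed.
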